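(* Let $H=(U,V,E)$ be a finite connected bipartite graph with $|U|\le|V|$. Then: (i) the graph $St(H)$ is enumeratively K\H{o}nig-Egerv\'ary, i.e. every minimum vertex cover $\mathcal{C}$ of $St(H)$ satisfies $\mathcal{C}=K_{\mathcal{M}}(St(H))$ for some maximal matching $\mathcal{M}$ of $St(H)$; and (ii) for every minimum vertex cover $\mathcal{C}$ of $H$ there is a maximal matching $\mathcal{M}$ of $St(H)$ such that $K_{\mathcal{M}}(St(H))\cap V(H)=\mathcal{C}$.
   Context: Let $3\star$ denote the star $K_{1,3}$. $St(H)$ is obtained from $H$ by attaching a copy of $3\star$ to every vertex $x$ of $H$, attaching meaning identifying $x$ with one leaf of a new copy of $3\star$ (equivalently: add a new vertex $c_x$ adjacent to $x$ and two new degree-one vertices adjacent to $c_x$). $St(H)$ is bipartite with bipartition $(X,Y)$ where $U\subseteq X$, $V\subseteq Y$ and $|X|\le|Y|$; K\H{o}nig's procedure on $St(H)$ is applied with $X$ as the smaller side. A matching is a set of pairwise vertex-disjoint edges; it is maximal if no edge can be added to it; a vertex is saturated if it is an endpoint of a matching edge. For a bipartite graph $G=(A,B,F)$ with designated smaller side $A$ and a matching $\mathcal{M}$, an alternating path is a path whose edges alternate between edges not in $\mathcal{M}$ and edges in $\mathcal{M}$; $Z_{\mathcal{M}}(G)$ is the set of vertices reachable by alternating paths starting at vertices of $A$ unsaturated by $\mathcal{M}$ (these start vertices included), and $K_{\mathcal{M}}(G):=(A\setminus Z_{\mathcal{M}}(G))\cup(B\cap Z_{\mathcal{M}}(G))$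 (K\H{o}nig's procedure). A minimum vertex cover is a vertex set meeting every edge, of smallest possible size. *)

(* Defs.v *)
From mathcomp Require Import all_boot.

Set Implicit Arguments.
Unset Strict Implicit.
Unset Printing Implicit Defensive.

Section Graphs.
Variables (T : finType) (e : rel T).
Implicit Types (A B C : {set T}) (M : {set {set T}}).

Definition simple_graph : Prop := symmetric e /\ irreflexive e.

Definition connected_graph : Prop := forall x y : T, connect e x y.

Definition bipartition A B : Prop :=
  [/\ [disjoint A & B], A :|: B = [set: T] &
      forall x y, e x y ->
        (x \in A) && (y \in B) || (x \in B) && (y \in A)].

Definition edges : {set {set T}} :=
  [set [set x; y] | x in T, y in T & e x y].

Definition vertex_cover C : Prop := forall x y, e x y -> x \in C \/ y \in C.

Definition min_vertex_cover C : Prop :=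
  vertex_cover C /\ forall D : {set T}, vertex_cover D -> #|C| <= #|D|.

Definition matching M : bool := (M \subset edges) && trivIset M.

(* Maximal for inclusion, not necessarily of maximum cardinality. *)
Definition maximal_matching M : Prop :=
  matching M /\
  forall f, f \in edges -> f \notin M -> ~~ matching (f |: M).

Definition saturated M (x : T) : bool := x \in cover M.

(* The vertex sequence of the path is x :: p; the pairmap lists, for each of
   its edges in turn, whether that edge belongs to M. *)
Definition alternating_path M (x : T) (p : seq T) : bool :=
  [&& path e x p, uniq (x :: p) &
      sorted (fun b c : bool => b != c)
        (pairmap (fun u v => [set u; v] \in M) x p)].

(* Since paths do not repeat vertices, bounding their length by #|T| is no
   restriction (see konig_reachP); it makes the quantifier finite. *)
Definition konig_reach A M : {set T} :=
  [set z | [exists a in A, ~~ saturated M a &&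
     [exists p : #|T|.-bseq T, alternating_path M a p && (last a p == z)]]].

Definition konig_cover A B M : {set T} :=
  (A :\: konig_reach A M) :|: (B :&: konig_reach A M).

Definition enumeratively_KE A B : Prop :=
  forall C, min_vertex_cover C ->
    exists M, maximal_matching M /\ C = konig_cover A B M.

Lemma konig_reachP A M z :
  reflect (exists a p, [/\ a \in A, ~~ saturated M a,
                           alternating_path M a p & last a p = z])
          (z \in konig_reach A M).
Proof.
rewrite inE; apply: (iffP exists_inP).
  case=> a aA /andP[nsat /existsP[p /andP[alt /eqP ez]]].
  by exists a, p.
case=> a [p [aA nsat alt ez]]; exists a => //; rewrite nsat /=.
have szp : size p <= #|T|.
  case/and3P: alt => _ /card_uniqP sz _.
  by rewrite ltnW // -[(size p).+1]/(size (a :: p)) -sz max_card.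
by apply/existsP; exists (Bseq szp); rewrite /= alt ez eqxx.
Qed.

End Graphs.

(* inl x is the vertex x of H, inr (x, None) is the centre c_x of the star
   attached at x, and inr (x, Some b), b : bool, are the two new vertices of
   degree one adjacent to c_x. *)
Definition St_vertex (T : finType) : finType := (T + T * option bool)%type.

Definition St (T : finType) (e : rel T) : rel (St_vertex T) :=
  fun p q => match p, q with
  | inl x, inl y => e x y
  | inl x, inr (y, None) | inr (y, None), inl x => x == y
  | inr (x, None), inr (y, Some _) | inr (y, Some _), inr (x, None) => x == y
  | _, _ => false
  end.

Definition St_base (T : finType) (A : {set T}) : {set St_vertex T} :=
  [set inl x | x in A].

(* If (A, B) is the bipartition of H, this is the side of St(H) containing A;
   the other side is St_side B A. *)
Definition St_side (T : finType) (A B : {set T}) : {set St_vertex T} :=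
  [set p : St_vertex T | match p with
                         | inl x => x \in A
                         | inr (x, None) => x \in B
                         | inr (x, Some _) => x \in A
                         end].

Lemma St_simple (T : finType) (e : rel T) :
  simple_graph e -> simple_graph (St e).
Proof.
case=> es ei; split.
  by move=> [x|[x [b|]]] [y|[y [c|]]] //=; rewrite eq_sym.
by move=> [x|[x [b|]]] /=.
Qed.

Lemma St_bipartition (T : finType) (e : rel T) (U V : {set T}) :
  bipartition e U V -> bipartition (St e) (St_side U V) (St_side V U).
Proof.
case=> dUV cUV eUV.
have UV x : (x \in V) = (x \notin U).
  have := in_setT x; rewrite -cUV inE.
  by case: (boolP (x \in U)) => //= xU _; rewrite (disjointFr dUV xU).
split.
- rewrite -setI_eq0; apply/eqP/setP => -[x|[x [b|]]];
  by rewrite !inE /= UV; case: (x \in U).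
- by apply/setP => -[x|[x [b|]]]; rewrite !inE /= UV; case: (x \in U).
move=> [x|[x [b|]]] [y|[y [c|]]] //=; rewrite !inE; first exact: eUV.
all: by move/eqP=> ->; rewrite UV; case: (_ \in U).
Qed.

Lemma St_base_sub (T : finType) (A B : {set T}) :
  St_base A \subset St_side A B.
Proof. by apply/subsetP => _ /imsetP[x xA ->]; rewrite inE. Qed.

Lemma card_St_side (T : finType) (A B : {set T}) :
  #|St_side A B| = 3 * #|A| + #|B|.
Proof.
pose f b x : St_vertex T := inr (x, b).
have fI b : injective (f b) by move=> x y [].
have -> : St_side A B = St_base A :|: (f (Some true) @: A :|:
                          (f (Some false) @: A :|: f None @: B)).
  have bI : injective (@inl T (T * option bool)) by move=> x y [].
  have fE b c x (D : {set T}) :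
      (inr (x, c) \in f b @: D) = (c == b) && (x \in D).
    apply/imsetP/andP => [[y yD [-> ->]]|[/eqP-> xD]]; last by exists x.
    by rewrite eqxx.
  have fN b x (D : {set T}) : (inl x \in f b @: D) = false.
    by apply/imsetP => -[].
  have bN q (D : {set T}) : (inr q \in St_base D) = false.
    by apply/imsetP => -[].
  by apply/setP => -[x|[x [[]|]]]; rewrite !inE ?fE ?fN ?bN ?orbF //= mem_imset.
have disj b c (D E : {set T}) : b != c -> f b @: D :&: f c @: E = set0.
  move=> /eqP bc; apply/setP => p; rewrite !inE; apply/andP.
  by case=> /imsetP[x _ ->] /imsetP[y _ []].
have disj0 b (D E : {set T}) : St_base D :&: f b @: E = set0.
  apply/setP => p; rewrite !inE; apply/andP.
  by case=> /imsetP[x _ ->] /imsetP[y _].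
rewrite !cardsU !setIUr !disj0 !disj // !setU0 cards0 !subn0.
by rewrite !card_imset //; [rewrite !mulSn mul0n addn0 !addnA | move=> x y []].
Qed.

Lemma leq_card_St_side (T : finType) (U V : {set T}) :
  #|U| <= #|V| -> #|St_side U V| <= #|St_side V U|.
Proof.
move=> le; rewrite !card_St_side !mulSn mul0n addn0 -!addnA.
by rewrite [#|V| + #|U|]addnC !leq_add.
Qed.

(* Main.v *)
(** A minimum vertex cover of [St H] consists of all the star centres and of a
minimum vertex cover [C] of [H], so both claims follow from one construction.
By minimality of [C] and Hall's theorem there is a matching of [U :&: C] into
[V :\: C]. Add to it the edges from [x] to [c_x] for [x] in [U :\: C], and one
pendant edge at every other centre. The resulting matching saturates [U] and all
centres, hence is maximal. König's procedure starts at unsaturated leaves over [U]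
and reaches the centres over [U], from there exactly the vertices of [U :\: C],
and from those exactly the vertices of [V :&: C], which are unsaturated. *)
Require Import Defs.
From mathcomp Require Import all_boot.

Set Implicit Arguments.
Unset Strict Implicit.
Unset Printing Implicit Defensive.

(** * Hall's marriage theorem *)

(* Rado's argument: shrink the sets [N x] as long as Hall's condition survives.
   If [N x] has two elements and neither can be removed, the two violating sets
   contradict the submodularity of [S |-> #|\bigcup_(x in S) N x|]. *)
Theorem hall (I T : finType) (f0 : I -> T) (A : {set I}) (N : I -> {set T}) :
    (forall S : {set I}, S \subset A -> #|S| <= #|\bigcup_(x in S) N x|) ->
  exists f : I -> T, {in A &, injective f} /\ {in A, forall x, f x \in N x}.
Proof.
have [n] := ubnP (\sum_(x in A) #|N x|); elim: n N => // n IH N leN hallN.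
pose shrink x y z := if z == x then N x :\ y else N z.
have shrinkN x y z : shrink x y z \subset N z.
  by rewrite /shrink; case: eqP => [->|//]; apply: subsetDl.
have [/exists_inP[x xA /exists_inP[y yN /forall_inP ok]]|] :=
  boolP [exists x in A, exists y in N x,
           [forall S : {set I} in powerset A,
              #|S| <= #|\bigcup_(z in S) shrink x y z|]].
  have [||f [fI fN]] := IH (shrink x y).
  - rewrite -ltnS (leq_ltn_trans _ leN) //.
    rewrite (bigD1 x) //= [leqRHS](bigD1 x) //= /shrink eqxx [#|N x|](cardsD1 y).
    rewrite yN -addSn leq_add // leq_sum // => z /andP[_ /negPf->].
    exact: leqnn.
  - by move=> S SA; apply: ok; rewrite inE.
  by exists f; split=> // z /fN; apply/subsetP.
move=> stuck.
(* A set violating Hall's condition after the removal of [y] from [N x] must contain [x]. The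
   witness drops [x], which turns the strict inequality into a weak one. *)
have badE x y : x \in A -> y \in N x -> exists2 S : {set I},
    (S \subset A) && (x \notin S) & #|\bigcup_(z in S) N z :|: N x :\ y| <= #|S|.
  move=> xA yN; move: stuck; rewrite negb_exists_in => /forall_inP/(_ x xA).
  rewrite negb_exists_in => /forall_inP/(_ y yN).
  rewrite negb_forall_in => /exists_inP[S]; rewrite inE -ltnNge => SA lt.
  have xS : x \in S.
    apply: contraLR lt => xS; rewrite -leqNgt (leq_trans (hallN S SA)) //.
    rewrite (eq_bigr (shrink x y)) // => z zS; rewrite /shrink ifN //.
    by apply: contraNneq xS => <-.
  exists (S :\ x); first by rewrite (subset_trans (subsetDl _ _) SA) !inE eqxx.
  move: lt; rewrite (cardsD1 x S) xS ltnS; congr (#|pred_of_set _| <= _).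
  rewrite (big_setD1 x) //= setUC; congr (_ :|: _); last by rewrite /shrink eqxx.
  by apply: eq_bigr => z /setD1P[/negPf zx _]; rewrite /shrink zx.
have N_le1 x y z : x \in A -> y \in N x -> z \in N x -> y = z.
  move=> xA yN zN; apply/eqP; apply: contraT => yz.
  have [S /andP[SA xS] leS] := badE x y xA yN.
  have [R /andP[RA xR] leR] := badE x z xA zN.
  (* As [y != z], the two punctured copies of [N x] have union [N x]. Hall's condition for
     [x |: (S :|: R)] bounds the union below, with one to spare, and for [S :&: R] the
     intersection. *)
  have := leq_add leS leR; rewrite -cardsUI -[leqRHS]cardsUI leqNgt.
  case/negP; rewrite -addSn leq_add //.
    have /hallN : x |: (S :|: R) \subset A.
      by rewrite !subUset sub1set xA SA.
    rewrite cardsU1 inE negb_or xS xR => /leq_trans-> //.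
    apply/subset_leq_card/bigcupsP => w; rewrite !inE => /or3P[/eqP->|wS|wR].
    - apply/subsetP=> t tN; rewrite !inE tN !andbT.
      by have [->|_] := eqVneq t y; rewrite ?yz ?orbT.
    - by rewrite -setUA subsetU // (bigcup_sup w).
    - by rewrite subsetU // orbC subsetU // (bigcup_sup w).
  have /hallN/leq_trans-> // : S :&: R \subset A by rewrite subIset ?SA.
  apply/subset_leq_card/bigcupsP => w /setIP[wS wR].
  by rewrite subsetI !subsetU // (bigcup_sup w).
(* The default [f0 x] is taken only outside [A]: Hall's condition on singletons makes [N x] nonempty
   for [x] in [A]. *)
pose f x := odflt (f0 x) [pick y in N x].
have fN : {in A, forall x, f x \in N x}.
  move=> x xA; rewrite /f; case: pickP => //= N0.
  have /hallN : [set x] \subset A by rewrite sub1set.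
  by rewrite cards1 big_set1 (eq_card0 N0).
exists f; split=> // x y xA yA fxy; apply/eqP; apply: contraT => xy.
(* Here [N x] and [N y] would be the same singleton, too small for a pair. *)
have /hallN : [set x; y] \subset A by rewrite subUset !sub1set xA.
rewrite cards2 xy bigcup_setU !big_set1 leqNgt ltnS /= => /negP[].
rewrite -(cards1 (f x)) subset_leq_card //; apply/subsetP => z.
rewrite !inE => /orP[zN|zN]; apply/eqP; first exact: (N_le1 x) (fN x xA).
by rewrite fxy; apply: (N_le1 y) (fN y yA).
Qed.

(** * Matchings given by a function, and König's procedure on them *)

Lemma maximal_matching_cover (T : finType) (e : rel T) (M : {set {set T}}) :
    matching e M -> (forall x y, e x y -> saturated M x || saturated M y) ->
  maximal_matching e M.
Proof.
move=> matM satM; split=> // f /imset2P[x y _]; rewrite inE => /andP[_ exy] -> fM.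
apply/negP => /andP[_ /trivIsetP triv].
(* An edge that can be added is disjoint from all edges of [M], so neither of its ends is
   saturated. *)
have dis z : z \in [set x; y] -> ~~ saturated M z.
  move=> zf; apply/negP => /bigcupP[g gM zg].
  have := triv [set x; y] g (setU11 _ _) (setU1r _ gM).
  rewrite (contraNneq _ fM) => [/(_ isT)/disjointFr/(_ zf)|->//].
  by rewrite zg.
by have := satM x y exy; rewrite !(negPf (dis _ _)) // !inE eqxx ?orbT.
Qed.

Section MatchingOfFunction.
Variables (T : finType) (e : rel T) (A B D : {set T}) (h : T -> T).
Hypothesis bip : bipartition e A B.
Hypothesis DA : D \subset A.
Hypothesis h_edge : {in D, forall a, e a (h a)}.
Hypothesis h_inj : {in D &, injective h}.

(** Encoding a matching by the set [D] of its saturated vertices in [A] and their partners [h] turns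
    membership of an edge into an equation between vertices. *)
Definition fun_matching : {set {set T}} := [set [set a; h a] | a in D].

Let notAB a : a \in A -> a \in B = false.
Proof. by case: bip => dAB _ _; apply: disjointFr. Qed.

Let hB : {in D, forall a, h a \in B}.
Proof.
move=> a aD; have [_ _ /(_ _ _ (h_edge aD))] := bip.
by rewrite (notAB (subsetP DA a aD)) (subsetP DA a aD) orbF.
Qed.

Let nhA a b : a \in D -> b \in A -> (b == h a) = false.
Proof. by move=> /hB hb /notAB bB; apply: contraTF hb => /eqP <-; rewrite bB. Qed.

Lemma matching_fun : matching e fun_matching.
Proof.
apply/andP; split.
  apply/subsetP => _ /imsetP[a aD ->]; apply/imset2P.
  by exists a (h a); rewrite ?inE ?h_edge.
apply/trivIsetP => _ _ /imsetP[a aD ->] /imsetP[b bD ->] nab.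
have ab : a != b by apply: contraNneq nab => ->.
rewrite -setI_eq0; apply/eqP/setP => z; rewrite !inE.
apply/negP => /andP[/orP[]/eqP-> /orP[]].
- by rewrite (negPf ab).
- by rewrite nhA // (subsetP DA).
- by rewrite eq_sym nhA // (subsetP DA).
- by rewrite (inj_in_eq h_inj) // (negPf ab).
Qed.

Lemma saturated_funl a : a \in A -> saturated fun_matching a = (a \in D).
Proof.
move=> aA; apply/bigcupP/idP => [[_ /imsetP[b bD ->]]|aD].
  by rewrite !inE nhA // orbF => /eqP->.
by exists [set a; h a]; [apply: imset_f | rewrite !inE eqxx].
Qed.

Lemma saturated_funr a : a \in D -> saturated fun_matching (h a).
Proof.
move=> aD; apply/bigcupP; exists [set a; h a]; first exact: imset_f.
by rewrite !inE eqxx orbT.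
Qed.

Lemma mem_fun_matching a b :
  a \in A -> ([set a; b] \in fun_matching) = (a \in D) && (b == h a).
Proof.
move=> aA; apply/imsetP/andP => [[c cD abc]|[aD /eqP->]]; last by exists a.
have : a \in [set c; h c] by rewrite -abc !inE eqxx.
rewrite !inE nhA // orbF => /eqP ac; move: cD abc; rewrite -ac => aD abc.
split=> //; have : h a \in [set a; b] by rewrite abc !inE eqxx orbT.
by rewrite !inE eq_sym nhA // eq_sym.
Qed.

(** An alternating path from an unsaturated vertex of [A] begins outside the matching, so it goes
    from [A] to [B] along non-matching edges and returns along matching ones. A set containing the
    starting points and closed under both moves contains everything reached. *)
Lemma konig_reach_fun_sub (Z : {set T}) :
    {in A :\: D, forall a, a \in Z} ->
    (forall a b, a \in A -> a \in Z -> e a b -> b \in Z) ->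
    (forall a, a \in D -> h a \in Z -> a \in Z) ->
  konig_reach e A fun_matching \subset Z.
Proof.
move=> Z0 ZA ZB; apply/subsetP => z /konig_reachP[a [p [aA nsat]]].
case/and3P=> pth _ alt <-; have aZ : a \in Z.
  by apply: Z0; rewrite !inE aA -saturated_funl // nsat.
pose in_M u v := [set u; v] \in fun_matching.
(* The label [true] in front pretends that the start was entered by a matching edge, so that the
   invariant below holds from the first vertex on. *)
have {nsat} alt : path (fun b c : bool => b != c) true (pairmap in_M a p).
  case: p alt pth => //= b p alt _; rewrite alt andbT /in_M mem_fun_matching //.
  by rewrite -saturated_funl // (negPf nsat).
(* Invariant for the induction: the last label is [true] at a vertex of [A] and [false] at a vertex
   of [B]. *)
have {}alt : (a \in A) && path (fun b c : bool => b != c) true (pairmap in_M a p)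
    || (a \in B) && path (fun b c : bool => b != c) false (pairmap in_M a p).
  by rewrite aA alt.
elim: p a {aA} aZ pth alt => //= b p IH a aZ /andP[eab pth].
have [_ _ /(_ a b eab)] := bip => abAB.
case/orP => /and3P[aAB mab alt].
  have bB : b \in B by move: abAB; rewrite aAB (notAB aAB) orbF.
  apply: IH => //; first exact: ZA eab.
  by apply/orP; right; rewrite bB; move: mab alt; case: (in_M _ _).
have bA : b \in A.
  move: abAB; case: (boolP (a \in A)) => [/notAB|_]; first by rewrite aAB.
  by rewrite aAB.
move: mab alt; case E: (in_M a b) => // _ alt.
apply: IH; rewrite ?bA ?alt //.
move: E; rewrite /in_M setUC mem_fun_matching // => /andP[bD /eqP hb].
by apply: ZB => //; rewrite -hb.
Qed.

End MatchingOfFunction.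

(** * Two exchange properties of minimum vertex covers *)

Lemma hall_min_vertex_cover (T : finType) (e : rel T) (U V C : {set T}) :
    simple_graph e -> bipartition e U V -> min_vertex_cover e C ->
  exists f : T -> T, {in U :&: C &, injective f} /\
    {in U :&: C, forall x, e x (f x) /\ f x \notin C}.
Proof.
move=> [es _] [dUV _ eUV] [covC minC].
pose N x := [set y | e x y && (y \notin C)].
have [S SUC|f [fI fN]] := @hall T T id (U :&: C) N; last first.
  by exists f; split=> // x /fN; rewrite inE => /andP.
have /subsetIP[SU SC] := SUC.
(* Exchanging [S] for its neighbours outside [C] leaves a cover, so minimality of [C] is Hall's
   condition for [S]. *)
pose D := C :\: S :|: \bigcup_(x in S) N x.
have half x y : e x y -> x \in C -> x \in D \/ y \in D.
  move=> exy xC; case: (boolP (x \in S)) => xS; last by left; rewrite !inE xS xC.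
  right; rewrite !inE; case: (boolP (y \in C)) => yC.
    rewrite andbT; apply/orP; left; apply/negP => /(subsetP SU) yU.
    have := eUV x y exy.
    by rewrite (disjointFr dUV yU) (disjointFr dUV (subsetP SU x xS)) andbF.
  by apply/orP; right; apply/bigcupP; exists x; rewrite // inE exy.
have /minC leD : vertex_cover e D.
  move=> x y exy; case: (covC x y exy) => [|yC]; first exact: half.
  by rewrite es in exy; case: (half y x exy yC); [right|left].
rewrite -(leq_add2l #|C :\: S|) addnC.
rewrite -{1}(setIidPr SC) cardsID (leq_trans leD) //.
by rewrite cardsU leq_subr.
Qed.

(** Otherwise [C :\ x] would still be a cover. For [x] in [V :&: C] this supplies the vertex of
    [U :\: C] from which König's procedure reaches [x]. *)
Lemma min_vertex_cover_neighbor (T : finType) (e : rel T) (C : {set T}) x :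
    simple_graph e -> min_vertex_cover e C -> x \in C ->
  exists2 y, e x y & y \notin C.
Proof.
move=> [es ei] [covC minC] xC; apply/exists_inP; apply: contraT.
rewrite negb_exists_in => /forall_inP nb.
have /minC : vertex_cover e (C :\ x).
  move=> y z eyz; have nyz : y != z by apply: contraTneq eyz => ->; rewrite ei.
  rewrite !inE; have [yx|_] := eqVneq y x.
    have := nb z; rewrite -yx eyz => /(_ isT); rewrite negbK => ->.
    by right; rewrite eq_sym nyz.
  have [zx|_] := eqVneq z x; last exact: covC.
  by have := nb y; rewrite -zx es eyz => /(_ isT); rewrite negbK => ->; left.
by rewrite (cardsD1 x C) xC ltnn.
Qed.

(** * Minimum vertex covers of [St e] *)

Definition St_cover (T : finType) (C : {set T}) : {set St_vertex T} :=
  [set p : St_vertex T | match p with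
                         | inl x => x \in C
                         | inr (_, b) => b == None
                         end].

Lemma card_St_cover (T : finType) (C : {set T}) : #|St_cover C| = #|C| + #|T|.
Proof.
pose c x : St_vertex T := inr (x, None).
have -> : St_cover C = St_base C :|: c @: [set: T].
  apply/setP => p; rewrite !inE; apply/idP/orP.
    case: p => [x xC|[x [//|_]]]; first by left; apply: imset_f.
    by right; apply: imset_f.
  by case=> /imsetP[x ? ->].
rewrite cardsU !card_imset ?cardsT; [|by move=> x y []..].
rewrite (_ : _ :&: _ = set0) ?cards0 ?subn0 //.
by apply/setP => p; rewrite !inE; apply/andP => -[/imsetP[x _ ->] /imsetP[]].
Qed.

Lemma vertex_cover_St (T : finType) (e : rel T) (C : {set T}) :
  vertex_cover e C -> vertex_cover (St e) (St_cover C).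
Proof.
by move=> cov [x|[x [b|]]] [y|[y [c|]]] //= => [/cov||||]; rewrite !inE; auto.
Qed.

Lemma min_vertex_cover_St (T : finType) (e : rel T) (D : {set St_vertex T}) :
    min_vertex_cover (St e) D ->
  exists2 C : {set T}, min_vertex_cover e C & D = St_cover C.
Proof.
move=> [covD minD]; pose C := [set x | inl x \in D].
have covC : vertex_cover e C by move=> x y; rewrite !inE; apply: (covD (inl x) (inl y)).
(* If [D] misses a centre, it contains both leaves there. Sending that centre to the leaf
   [Some true] injects [St_cover C] into [D], and minimality of [D] makes this a bijection. *)
pose phi (p : St_vertex T) : St_vertex T :=
  if p is inr (x, None) then
    if inr (x, None) \in D then p else inr (x, Some true)
  else p.
have phiI : {in St_cover C &, injective phi}.
  move=> [x|[x [b|]]] [y|[y [c|]]] //; rewrite !inE //=; do ?by case: ifP.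
  by move=> _ _; case: ifP => ?; case: ifP => ? // -[->].
have phiD : phi @: St_cover C \subset D.
  apply/subsetP => _ /imsetP[[x|[x [b|]]] + ->]; rewrite !inE //= => _.
  case: ifP => // cD; have := covD (inr (x, None)) (inr (x, Some true)) (eqxx x).
  by rewrite cD => -[].
have cardD : #|D| = #|St_cover C|.
  apply/eqP; rewrite eqn_leq (minD _ (vertex_cover_St covC)).
  by rewrite -(card_in_imset phiI) subset_leq_card.
have imD : phi @: St_cover C = D.
  by apply/eqP; rewrite eqEcard phiD cardD card_in_imset /=.
(* The image of [phi] avoids the leaves [Some false], so [D] needs every centre and [phi] is the
   identity. *)
have leafD x : inr (x, Some false) \notin D.
  rewrite -imD; apply/negP => /imsetP[[y|[y [b|]]]]; rewrite !inE //=.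
  by move=> _; case: ifP.
have centreD x : inr (x, None) \in D.
  have := covD (inr (x, None)) (inr (x, Some false)) (eqxx x).
  by rewrite (negPf (leafD x)) => -[].
have phi_id p : phi p = p by case: p => [x|[x [b|]]] //=; rewrite centreD.
have DE : D = St_cover C by rewrite -{1}imD (eq_imset _ phi_id) imset_id.
exists C => //; split=> // E covE.
rewrite -(leq_add2r #|T|) -!card_St_cover -DE.
exact/minD/vertex_cover_St.
Qed.

(** * The matching of [St e] built from a minimum cover of [H] *)

Lemma konig_cover_St (T : finType) (e : rel T) (U V C : {set T}) :
    simple_graph e -> bipartition e U V -> min_vertex_cover e C ->
  exists M : {set {set St_vertex T}}, maximal_matching (St e) M /\
    konig_cover (St e) (St_side U V) (St_side V U) M = St_cover C.
Proof.
move=> simple_e bip minC; have [f [fI fC]] := hall_min_vertex_cover simple_e bip minC.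
have neighC := min_vertex_cover_neighbor simple_e minC.
have [es _] := simple_e; have [covC _] := minC.
have [dUV cUV eUV] := bip.
have UV x : (x \in V) = (x \notin U).
  have := in_setT x; rewrite -cUV inE.
  by case: (boolP (x \in U)) => //= xU _; rewrite (disjointFr dUV xU).
have eN x y : e x y -> (y \in U) = (x \notin U).
  by move=> /eUV; rewrite !UV; case: (x \in U); case: (y \in U).
have Sbip := St_bipartition bip.
pose h (p : St_vertex T) : St_vertex T := match p with
  | inl x => if x \in C then inl (f x) else inr (x, None)
  | inr (x, None) => inr (x, Some true)
  | inr (x, Some _) => inr (x, None)
  end.
(* These are the saturated vertices on the side of [U]. No leaf [Some false] is ever matched, so
   over [U] these leaves are starting points. *)
pose D := [set p : St_vertex T | match p with
  | inl x => x \in U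
  | inr (x, None) => x \notin U
  | inr (x, Some b) => [&& x \in U, x \in C & b]
  end].
have DX : D \subset St_side U V.
  apply/subsetP => -[x|[x [b|]]]; rewrite !inE ?UV //.
  by case/and3P.
have h_edge : {in D, forall p, St e p (h p)}.
  move=> [x|[x [b|]]]; rewrite !inE //= => xU.
  case: ifP => //= xC; by have [] := fC x; rewrite // inE xU.
(* Within [D], the centre at [x] in [U] is the partner of [inl x] only if [x \notin C], and of a
   leaf only if [x \in C]. *)
have h_inj : {in D &, injective h}.
  move=> [x|[x b]] [y|[y c]]; rewrite !inE /=.
  - move=> xU yU; case: ifP => xC; case: ifP => yC // -[] xy.
      by congr inl; apply: fI; rewrite ?inE ?xU ?yU.
    by rewrite xy.
  - case: c => [c|]; case: ifP => xC //= xU /and3P[_ yC _] [xy].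
    by rewrite -xy xC in yC.
  - case: b => [b|]; case: ifP => yC //= /and3P[_ xC _] yU [xy].
    by rewrite xy yC in xC.
  - case: b => [b|]; case: c => [c|] //= xD yD [xy]; last by rewrite xy.
    by move: xD yD; rewrite xy => /and3P[_ _ ->] /and3P[_ _ ->].
pose M := fun_matching D h.
have memM a b := mem_fun_matching Sbip DX h_edge b : a \in _ -> _.
have satl := saturated_funl Sbip DX h_edge.
have satr a : a \in D -> saturated M (h a) := @saturated_funr _ D h a.
have sat_centre x : saturated M (inr (x, None)).
  case: (boolP (x \in U)) => xU; last by rewrite satl !inE ?UV.
  case: (boolP (x \in C)) => xC.
    by apply: (satr (inr (x, Some true))); rewrite !inE xU xC.
  by have := satr (inl x); rewrite !inE /= (negPf xC); apply.
(* Every edge of [St e] has a centre or a vertex of [U] as an end, and all of these are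
   saturated. *)
have sat_U x : x \in U -> saturated M (inl x) by move=> xU; rewrite satl !inE.
have maxM : maximal_matching (St e) M.
  apply: maximal_matching_cover; first exact: matching_fun Sbip DX h_edge h_inj.
  move=> [x|[x [b|]]] [y|[y [c|]]] //=; rewrite ?sat_centre ?orbT //.
  by move=> /eN yx; case: (boolP (x \in U)) yx => [/sat_U->|_ /sat_U->]; rewrite ?orbT.
(* The expected reach: it has to miss [U :&: C] and the centres over [V], and to contain [V :&: C]
   and the centres over [U]. *)
pose Z := [set p : St_vertex T | match p with
  | inl x => if x \in U then x \notin C else x \in C
  | inr (x, _) => x \in U
  end].
have reachE : konig_reach (St e) (St_side U V) M = Z.
  apply/eqP; rewrite eqEsubset; apply/andP; split.
    apply: (konig_reach_fun_sub Sbip DX h_edge).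
    - by move=> [x|[x [b|]]]; rewrite !inE ?UV => /andP[] // /negPf->.
    - move=> [x|[x [b|]]] [y|[y [c|]]] //=; rewrite !inE ?UV //.
      + move=> xU; rewrite xU => xC exy; rewrite (eN x y exy) xU /=.
        by case: (covC x y exy) => //; rewrite (negPf xC).
      + by move=> + + /eqP <-.
      + by move=> + + /eqP ->.
      + by move=> /negPf->.
      + by move=> /negPf->.
    - move=> [x|[x [b|]]]; rewrite !inE //= => xU; rewrite xU.
      case: ifP => //= xC; have [|exf fxC] := fC x; first by rewrite inE xU.
      by rewrite (eN _ _ exf) xU /= (negPf fxC).
  (* Conversely, each vertex of [Z] is the end of an explicit path of at most three edges, starting
     at an unsaturated leaf over [U]. *)
  apply/subsetP => p pZ; apply/konig_reachP.
  pose l x b : St_vertex T := inr (x, Some b); pose c x : St_vertex T := inr (x, None).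
  have lX x b : x \in U -> l x b \in St_side U V by rewrite inE.
  have lD x b : l x b \in D = [&& x \in U, x \in C & b] by rewrite inE.
  have lc x y b : (l x b == c y) = false by apply/eqP.
  have li x y b : (l x b == inl y) = false by apply/eqP.
  have MlcE x b :
      x \in U -> ([set inr (x, Some b); inr (x, None)] \in M) = (x \in C) && b.
    by move=> xU; rewrite memM ?lX // lD xU eqxx andbT.
  have McxE x :
      x \in U -> ([set inr (x, None); inl x] \in M) = (x \notin C).
    move=> xU; rewrite setUC memM ?inE // xU /=.
    by case: (x \in C); rewrite ?eqxx.
  have nsat x : x \in U -> ~~ saturated M (l x false).
    by move=> xU; rewrite satl ?lX // lD !andbF.
  have alt_x x : x \in U -> x \notin C ->
      alternating_path (St e) M (l x false) [:: c x; inl x].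
    move=> xU xC; apply/and3P; split; rewrite /= ?eqxx ?inE ?lc ?li //.
    by rewrite MlcE // McxE // xC andbF.
  case: p pZ => [x|[x [b|]]]; rewrite inE => xZ.
  - case: ifP xZ => xU xC.
      by exists (l x false), [:: c x; inl x]; rewrite lX ?nsat ?alt_x.
    have [y exy yC] := neighC x xC.
    have yU : y \in U by rewrite (eN x y) ?xU.
    exists (l y false), [:: c y; inl y; inl x]; rewrite lX ?nsat //; split=> //.
    apply/and3P; split.
    + by rewrite /= !eqxx es exy.
    + rewrite /= !inE lc !li /= andbT; apply/negP => /eqP [yx].
      by rewrite yx xC in yC.
    + rewrite /= MlcE // McxE // yC andbF /= andbT.
      by rewrite memM ?inE // yU /= (negPf yC).
  (* The leaf [Some true] is matched to its centre if [x \in C], and is itself a starting point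
     otherwise. *)
  - case: b; last by exists (l x false), [::]; rewrite lX ?nsat.
    case: (boolP (x \in C)) => xC.
      exists (l x false), [:: c x; l x true]; rewrite lX ?nsat //; split=> //.
      apply/and3P; split; rewrite /= ?eqxx //.
        by rewrite /= !inE lc andbT; apply/andP; split; apply/eqP.
      by rewrite MlcE // setUC MlcE // xC.
    exists (l x true), [::]; rewrite lX //; split=> //.
    by rewrite satl ?lX // lD (negPf xC) andbF.
  - exists (l x false), [:: c x]; rewrite lX ?nsat //; split=> //.
    by apply/and3P; split; rewrite /= ?eqxx ?inE ?lc.
exists M; split=> //; rewrite /konig_cover reachE.
apply/setP => -[x|[x [b|]]]; rewrite !inE ?UV; case: (x \in U) => //=;
  by rewrite ?negbK ?andbT ?orbF ?andbF.
Qed.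

Theorem theorem3p11 (T : finType) (e : rel T) (U V : {set T})
    (H_simple : simple_graph e)
    (H_bip : bipartition e U V)
    (H_conn : connected_graph e)
    (H_card : #|U| <= #|V|) :
  enumeratively_KE (St e) (St_side U V) (St_side V U) /\
  (forall C : {set T}, min_vertex_cover e C ->
     exists M : {set {set St_vertex T}},
       maximal_matching (St e) M /\
       konig_cover (St e) (St_side U V) (St_side V U) M :&: St_base [set: T]
         = St_base C).
Proof.
split=> [D /min_vertex_cover_St[C minC ->]|C minC];
  have [M [maxM KE]] := konig_cover_St H_simple H_bip minC; exists M => //.
rewrite KE; split=> //; apply/setP => p; rewrite inE; apply/andP/imsetP.
  by case=> + /imsetP[x _ px]; rewrite px inE => xC; exists x.
by case=> x xC ->; rewrite inE xC; split=> //; apply: imset_f.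
Qed.
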